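(* Let $\mathscr{D}$ be a real or complex vector space and let $\mathfrak{s}$ and $\mathfrak{t}$ be nonnegative Hermitian forms on $\mathscr{D}$ such that $\mathfrak{s}$ is absolutely continuous with respect to $\mathfrak{t}$. Then for each $f\in\mathfrak{H}_{\mathfrak{s}}$ there exists a sequence $(x_n)_{n\in\mathbb{N}}$ in $\mathscr{D}$ such that $$(x\,|\,f)_{\mathfrak{s}}=\lim_{n\to\infty}(x\,|\,x_n)_{\mathfrak{t}}\qquad\text{for all } x\in\mathscr{D}.$$ Moreover, the convergence is uniform on the set $\{x\in\mathscr{D}: \mathfrak{s}(x,x)+\mathfrak{t}(x,x)\leq 1\}$.
   Context: For a nonnegative Hermitian form $\mathfrak{s}$ on $\mathscr{D}$ (linear in the first variable), put $\mathscr{N}_{\mathfrak{s}}=\{x\in\mathscr{D}:\mathfrak{s}(x,x)=0\}$. The Hilbert space $\mathfrak{H}_{\mathfrak{s}}$ is the completion of $\mathscr{D}/\mathscr{N}_{\mathfrak{s}}$ with respect to the inner product $(x+\mathscr{N}_{\mathfrak{s}}\,|\,y+\mathscr{N}_{\mathfrak{s}})_{\mathfrak{s}}=\mathfrak{s}(x,y)$. For $x\in\mathscr{D}$ one writes $x$ also for the class $x+\mathscr{N}_{\mathfrak{s}}\in\mathfrak{H}_{\mathfrak{s}}$. The Hilbert space $\mathfrak{H}_{\mathfrak{t}}$ with inner product $(\cdot\,|\,\cdot)_{\mathfrak{t}}$ is defined in the same way from $\mathfrak{t}$. The form $\mathfrak{s}$ is absolutely continuous with respect to $\mathfrak{t}$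 if for every sequence $(x_n)_{n\in\mathbb{N}}$ in $\mathscr{D}$, the conditions $\mathfrak{t}(x_n,x_n)\to0$ and $\mathfrak{s}(x_n-x_m,x_n-x_m)\to0$ (as $n,m\to\infty$) imply $\mathfrak{s}(x_n,x_n)\to0$. *)

(* Defs.v *)
From HB Require Import structures.
From mathcomp Require Import all_boot all_order all_algebra.
From mathcomp Require Import complex.
From mathcomp Require Import all_classical all_reals all_analysis.

Set Implicit Arguments.
Unset Strict Implicit.
Unset Printing Implicit Defensive.

Import Order.TTheory GRing.Theory Num.Theory.
Import numFieldNormedType.Exports.

#[global] Open Scope classical_set_scope.
#[global] Open Scope ring_scope.

(* The scalar field with its conjugation is either the field R of real numbers
   with the identity, or R[i] with complex conjugation. *)
Variant real_or_complex (R : realType) :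
    forall K : numFieldType, {rmorphism K -> K} -> Prop :=
  | RealScalars : @real_or_complex R R idfun
  | ComplexScalars : @real_or_complex R R[i]%C Num.conj.

Section Forms.
Context {K : numFieldType} {conj : {rmorphism K -> K}} {D : lmodType K}.
Implicit Types s t : {hermitian_sym D for conj}.

(* On R[i], [0 <= z] says that z is a real number and is nonnegative. *)
Definition nonneg_form s := forall x : D, 0 <= s x x.

Definition abs_continuous s t := forall x_ : nat -> D,
  t (x_ n) (x_ n) @[n --> \oo] --> (0 : K) ->
  s (x_ p.1 - x_ p.2) (x_ p.1 - x_ p.2) @[p --> (\oo, \oo)] --> (0 : K) ->
  s (x_ n) (x_ n) @[n --> \oo] --> (0 : K).

(* H, with inner product ip, is a Hilbert space completion of the quotient of D
   by the kernel {x | s x x = 0}; j sends x to its class. The quotient is not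
   formed explicitly: by completion_form, j x = 0 iff s x x = 0, so j induces
   an isometric embedding of the quotient with the same range as j. *)
Record is_completion s (H : completeNormedModType K) (ip : {dot H for conj})
    (j : {linear D -> H}) : Prop := IsCompletion {
  completion_norm : forall h : H, `|h| ^+ 2 = ip h h;
  completion_form : forall x y : D, ip (j x) (j y) = s x y;
  completion_dense : dense (range j)
}.

End Forms.

(* Main.v *)
Require Import Defs.
From HB Require Import structures.
From mathcomp Require Import all_boot all_order all_algebra.
From mathcomp Require Import complex.
From mathcomp Require Import all_classical all_reals all_analysis.
From mathcomp Require Import ring.
Import Order.TTheory GRing.Theory Num.Theory.
Import numFieldNormedType.Exports.

(* For [f] in the completion, let [u n] minimise
   [G n u = |f - j u|_s ^ 2 + (n + 1) t(u, u)] over [D] up to [(n + 1) ^ -2].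
   The Euler-Lagrange equation says that [(j x | f - j (u n))_s] is close to
   [(n + 1) t(x, u n)], so [x_ n = (n + 1) u n] works as soon as
   [s(u n, u n)] tends to 0. Now [t(u n, u n)] is O(1/n), and since the minima
   of the [G n] increase to a finite limit, the parallelogram law makes [u n]
   Cauchy for [s]; absolute continuity concludes. *)

(** * Real and complex scalars, limits and near-minimisers *)

(** Common interface to the two scalar fields, so that later arguments need no case split: [iota]
    embeds the reals, and [rho], the identity or the real part, inverts it on nonnegative
    scalars. *)
Lemma real_or_complexP (R : realType) (K : numFieldType)
    (conj : {rmorphism K -> K}) : real_or_complex R conj ->
  exists (iota : {rmorphism R -> K}) (rho : K -> R),
    [/\ {mono iota : x y / x <= y}, forall z, 0 <= z -> iota (rho z) = z
      & forall z, `|z| ^+ 2 = z * conj z].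
Proof.
case.
  by exists idfun, id; split=> // z; rewrite real_normK ?num_real// expr2.
exists (real_complex R), (@complex.Re R); split.
- exact: lecR.
- by move=> z /ger0_real /RRe_real.
- exact: sqr_normc.
Qed.

Lemma conj_ge0_id {K : numFieldType} {conj : {rmorphism K -> K}}
    (conjN : forall z, `|z| ^+ 2 = z * conj z) (z : K) : 0 <= z -> conj z = z.
Proof.
have [->|z0] := eqVneq z 0; first by rewrite rmorph0.
move=> z_ge0; apply: (mulfI z0).
by rewrite -conjN ger0_norm// expr2.
Qed.

(** Every positive tolerance [e] in [K] is the image of the real [rho e], so the order embedding
    [iota] transports limits. *)
Lemma cvg_mono_rmorph {R : realType} {K : numFieldType}
    {iota : {rmorphism R -> K}} {rho : K -> R}
    (iota_mono : {mono iota : x y / x <= y})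
    (rhoK : forall z, 0 <= z -> iota (rho z) = z) (u : nat -> R) (l : R) :
  u n @[n --> \oo] --> l -> iota (u n) @[n --> \oo] --> iota l.
Proof.
move=> ul; apply/cvgrPdist_lt => e e0.
have iota_lt := leW_mono iota_mono.
have re0 : 0 < rho e by rewrite -iota_lt rmorph0 rhoK// ltW.
have iota_norm x : `|iota x| = iota `|x|.
  have [x0|x0] := leP 0 x.
    by rewrite !ger0_norm// -(rmorph0 iota) iota_mono.
  by rewrite !ltr0_norm ?rmorphN// -(rmorph0 iota) iota_lt.
have /cvgrPdist_lt/(_ _ re0) := ul.
apply: filterS => n.
by rewrite -rmorphB iota_norm -[in X in _ -> X](rhoK _ (ltW e0)) iota_lt.
Qed.

(* Without [%R], [^-1] is read here as the inverse of a function. *)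
Lemma cvg_inv_succ {R : realType} {K : numFieldType}
    {conj : {rmorphism K -> K}} (hK : real_or_complex R conj) :
  (n.+1%:R : K)^-1%R @[n --> \oo] --> (0 : K).
Proof.
have [iota [rho [imono rhoK _]]] := real_or_complexP _ _ _ hK.
have := cvg_mono_rmorph imono rhoK _ _ (@cvg_harmonic R).
rewrite rmorph0.
suff -> : (fun n => iota (@harmonic R n)) = (fun n => n.+1%:R^-1%R) by [].
by apply/funext => n; rewrite /harmonic /= fmorphV rmorph_nat.
Qed.

(* The minimal values increase and are bounded above, hence converge. *)
Lemma near_minimizers {R : realType} {K : numFieldType}
    {conj : {rmorphism K -> K}} (hK : real_or_complex R conj)
    {T : Type} (G : nat -> T -> K) (x0 : T) (c : K) :
  (forall n x, 0 <= G n x) ->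
  (forall n m x, (n <= m)%N -> G n x <= G m x) ->
  (forall n, G n x0 <= c) ->
  exists (mu : nat -> K) (u : nat -> T),
    [/\ forall n x, mu n <= G n x,
        forall n, G n (u n) <= mu n + n.+1%:R^-1 ^+ 2
      & cvg (mu n @[n --> \oo])].
Proof.
move=> G0 Gle Gc.
have [iota [rho [imono rhoK _]]] := real_or_complexP _ _ _ hK.
(* Values are pulled back to [R], whose order completeness gives the infima and the limit of the
   minimal values. *)
pose g n x := rho (G n x).
have iotag n x : iota (g n x) = G n x by rewrite rhoK.
pose m n := inf (range (g n)).
have g_lb n : has_lbound (range (g n)).
  by exists 0 => _ [x _ <-]; rewrite -imono rmorph0 iotag.
have g_inf n : has_inf (range (g n)) by split=> //; exists (g n x0), x0.
have m_le n x : m n <= g n x by apply: ge_inf => //; exists x.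
have /choice[u uP] n : exists x, g n x <= m n + n.+1%:R^-1 ^+ 2.
  have e0 : 0 < n.+1%:R^-1 ^+ 2 :> R by rewrite exprn_gt0.
  by have [_ [x _ <-] /ltW] := inf_adherent e0 (g_inf n); exists x.
exists (iota \o m), u; split.
- by move=> n x; rewrite -iotag imono.
- move=> n; rewrite -iotag -(rmorph_nat iota) -fmorphV.
  by rewrite -rmorphXn -rmorphD imono.
have m_cvg : cvg (m n @[n --> \oo]).
  apply: nondecreasing_is_cvgn.
    move=> n k nk; apply: lb_le_inf; first by exists (g k x0), x0.
    move=> _ [x _ <-]; apply: le_trans (m_le n x) _.
    by rewrite -imono !iotag Gle.
  exists (rho c) => _ [n _ <-]; apply: le_trans (m_le n x0) _.
  by rewrite -imono iotag rhoK// (le_trans _ (Gc 0%N)).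
apply/cvg_ex; exists (iota (limn m)).
exact: (cvg_mono_rmorph imono rhoK _ _ m_cvg).
Qed.

(** * Inequalities for scalars and Hermitian forms *)

Lemma ge0_le_cvg0 {K : numFieldType} {T : Type} {F : set_system T}
    {FF : Filter F} (f g : T -> K) :
  (forall x, 0 <= f x <= g x) -> g x @[x --> F] --> (0 : K) ->
  f x @[x --> F] --> (0 : K).
Proof.
move=> fg /cvgr0Pnorm_lt g0; apply/cvgr0Pnorm_lt => e /g0.
apply: filterS => x; apply: le_lt_trans.
have /andP[f0 fgx] := fg x.
by rewrite !ger0_norm// (le_trans f0).
Qed.

Lemma normD_sqr_le {K : numDomainType} (a b : K) :
  `|a + b| ^+ 2 <= (`|a| ^+ 2 + `|b| ^+ 2) *+ 2.
Proof.
apply: (@le_trans _ _ ((`|a| + `|b|) ^+ 2)).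
  by rewrite lerXn2r ?nnegrE ?addr_ge0// ler_normD.
rewrite -subr_ge0.
have -> : (`|a| ^+ 2 + `|b| ^+ 2) *+ 2 - (`|a| + `|b|) ^+ 2 =
    (`|a| - `|b|) ^+ 2.
  by ring.
by rewrite real_exprn_even_ge0 ?rpredB ?ger0_real.
Qed.

(** Discriminant bound behind both Cauchy-Schwarz and the Euler-Lagrange estimate. Taking [l] along
    the conjugate of [b] makes [l * b] real and leaves a real parameter [r]; for positive [q] the
    best choice is [r = 1 / q]. *)
Lemma quadratic_ge0_discr {K : numFieldType} {conj : {rmorphism K -> K}}
    (conjN : forall z, `|z| ^+ 2 = z * conj z) (e b q : K) :
  0 <= q ->
  (forall l, 0 <= e + (l * b + conj (l * b)) + `|l| ^+ 2 * q) ->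
  `|b| ^+ 2 <= e * q.
Proof.
move=> q0 pos.
have conjK := conj_ge0_id conjN.
have {}pos r : 0 <= r -> 0 <= e - `|b| ^+ 2 * r *+ 2 + `|b| ^+ 2 * r ^+ 2 * q.
  move=> r0; have [b0|b0] := eqVneq b 0.
    have := pos 0.
    by rewrite b0 normr0 expr0n/= !mul0r rmorph0 mul0rn subr0 !addr0.
  (* By [conjN] this is [- (r * conj b)]. *)
  pose l := - (r * (`|b| ^+ 2 / b)).
  have lb : l * b = - (r * `|b| ^+ 2) by rewrite /l mulNr -mulrA divfK.
  have nl : `|l| ^+ 2 = `|b| ^+ 2 * r ^+ 2.
    rewrite /l normrN !normrM normfV (ger0_norm r0) !normr_id.
    have : `|b| != 0 by rewrite normr_eq0.
    by move: (`|b|) => z z0; field.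
  have := pos l; rewrite lb nl rmorphN (conjK (r * _)) ?mulr_ge0//.
  suff -> : e - `|b| ^+ 2 * r *+ 2 =
    e + (- (r * `|b| ^+ 2) - r * `|b| ^+ 2) by [].
  by ring.
have e0 : 0 <= e.
  have := pos 0 (lexx _).
  by rewrite expr0n/= !mulr0 mul0rn mul0r subr0 addr0.
move: q0; rewrite le_eqVlt => /orP[/eqP q0|q0].
  rewrite -q0 mulr0; apply: contraT => B0.
  have {}B0 : 0 < `|b| ^+ 2.
    by rewrite lt_def exprn_ge0// andbT; apply: contraNneq B0 => ->.
  (* For [q = 0] the bound is affine in [r] and fails for large [r] unless [b = 0]; this [r] gives
     the value [- (e + 2)]. *)
  have /pos : 0 <= (e + 1) / `|b| ^+ 2 by rewrite divr_ge0 ?addr_ge0// ltW.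
  rewrite -q0 mulr0 addr0 [_ * (_ / _)]mulrC divfK ?gt_eqF//.
  have -> : e - (e + 1) *+ 2 = - (e + 2) by ring.
  by rewrite oppr_ge0 lt_geF// ltr_wpDl.
have /pos : 0 <= q^-1%R by rewrite invr_ge0 ltW.
have -> : e - `|b| ^+ 2 / q *+ 2 + `|b| ^+ 2 * q^-1 ^+ 2 * q =
    e - `|b| ^+ 2 / q.
  by have := gt_eqF q0; move: (`|b|) => z /negbT z0; field.
by rewrite subr_ge0 ler_pdivrMr.
Qed.

Lemma hermitian_normDZ {K : numFieldType} {conj : {rmorphism K -> K}}
    (conjN : forall z, `|z| ^+ 2 = z * conj z) {V : lmodType K}
    (B : {hermitian_sym V for conj}) (l : K) (x y : V) :
  B (l *: x + y) (l *: x + y) =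
  B y y + (l * B x y + conj (l * B x y)) + `|l| ^+ 2 * B x x.
Proof.
rewrite hnormD/= expr0 mul1r conjN linearZl_LR linearZr_LR linearZl_LR/=.
by ring.
Qed.

Lemma hermitian_Cauchy_Schwarz {K : numFieldType} {conj : {rmorphism K -> K}}
    (conjN : forall z, `|z| ^+ 2 = z * conj z) {V : lmodType K}
    (s : {hermitian_sym V for conj}) (s_ge0 : nonneg_form s) (x y : V) :
  `|s x y| ^+ 2 <= s y y * s x x.
Proof.
apply: (quadratic_ge0_discr conjN) => // l.
by rewrite -hermitian_normDZ.
Qed.

(** Parallelogram law, with the midpoint [z] given by an equation so that it serves for residuals in
    the completion and for vectors of [D] alike. *)
Lemma hermitian_midpoint {K : numFieldType} {conj : {rmorphism K -> K}}
    {V : lmodType K} (B : {hermitian_sym V for conj}) (x y z : V) :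
  x + y = z *+ 2 -> B x x + B y y = B z z *+ 2 + B (x - y) (x - y) / 2.
Proof.
move=> xy; have : B (x + y) (x + y) = B z z *+ 4.
  by rewrite xy linearMnl linearMnr -mulrnA.
rewrite hnormD hnormB/=; set d := B x y + _ => H.
have -> : B z z = (B x x + B y y + d) / 4 by rewrite H; field.
by field.
Qed.

(** * The penalised minimisation *)

(** The factor [c n] does not depend on [x], so this one estimate yields both pointwise and uniform
    convergence. *)
Lemma abs_continuous_approx {R : realType} {K : numFieldType}
    {conj : {rmorphism K -> K}} (hK : real_or_complex R conj)
    {D : lmodType K} {s t : {hermitian_sym D for conj}}
    (s_ge0 : nonneg_form s) (t_ge0 : nonneg_form t)
    (s_ac_t : abs_continuous s t)
    {H : lmodType K} (ip : {hermitian_sym H for conj}) (ip_ge0 : nonneg_form ip)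
    (j : {linear D -> H}) (ip_form : forall x y, ip (j x) (j y) = s x y)
    (f : H) :
  exists (x_ : nat -> D) (c : nat -> K),
    [/\ c n @[n --> \oo] --> (0 : K), forall n, 0 <= c n
      & forall n x, `|ip (j x) f - t x (x_ n)| ^+ 2 <= c n * (s x x + t x x)].
Proof.
have [_ [_ [_ _ conjN]]] := real_or_complexP _ _ _ hK.
pose G n (u : D) := ip (f - j u) (f - j u) + n.+1%:R * t u u.
have G0 n : G n 0 = ip f f by rewrite /G linear0 subr0 linear0l mulr0 addr0.
have [|n m u nm|n|mu [u [muG Gu mu_cvg]]] :=
    near_minimizers hK G 0 (ip f f).
- by move=> n u; rewrite addr_ge0// mulr_ge0.
- by rewrite lerD2l ler_wpM2r// ler_nat.
- by rewrite G0.
have mu_real n : mu n \is Num.real.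
  by rewrite (ler_real (muG n 0)) ger0_real// G0.
(* First-order coefficient of [G n] at [u n] along [- x]; it would vanish at an exact minimiser. *)
pose b n x := ip (j x) (f - j (u n)) - n.+1%:R * t x (u n).
(* Approximate Euler-Lagrange equation of [u n]. *)
have b_le n x : `|b n x| ^+ 2 <= (n.+1%:R : K)^-1%R * (s x x + t x x).
  have : `|b n x| ^+ 2 <= (n.+1%:R : K)^-1%R ^+ 2 * (s x x + n.+1%:R * t x x).
    apply: (quadratic_ge0_discr conjN) => [|l].
      by rewrite addr_ge0// mulr_ge0.
    have GE : G n (- l *: x + u n) = G n (u n) + (l * b n x + conj (l * b n x))
        + `|l| ^+ 2 * (s x x + n.+1%:R * t x x).
      have fE : f - j (- l *: x + u n) = l *: j x + (f - j (u n)).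
        by rewrite linearD linearZ/= scaleNr opprD opprK addrCA.
      rewrite /G fE !hermitian_normDZ// ip_form normrN /b.
      by ring.
    have := le_trans (Gu n) (lerD (muG n (- l *: x + u n)) (lexx _)).
    rewrite GE -subr_ge0.
    set e := _^-1%R ^+ 2; set d := l * _ + _; set w := `|l| ^+ 2 * _.
    suff -> : G n (u n) + d + w + e - G n (u n) = e + d + w by [].
    by ring.
  (* One factor of the squared tolerance absorbs the weight [n.+1] of [t]; the other remains as the
     rate. *)
  move=> /le_trans; apply.
  rewrite expr2 -mulrA ler_wpM2l// mulrDr mulKf ?pnatr_eq0// lerD2r.
  by rewrite ler_piMl// invf_le1 ?ler1n.
(* Parallelogram law at the midpoint [v] of [u n] and [u m]. *)
have u_le n m : (n <= m)%N -> s (u n - u m) (u n - u m) <=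
    (`|mu n - mu m| + ((n.+1%:R : K)^-1%R ^+ 2 + (m.+1%:R : K)^-1%R ^+ 2)) *+ 2.
  move=> nm.
  pose v := 2^-1%R *: (u n + u m).
  have v2 : u n + u m = v *+ 2 by rewrite -scaler_nat scalerA divff ?scale1r.
  have Gv : G n (u n) + G n (u m) = G n v *+ 2
      + (s (u n - u m) (u n - u m) + n.+1%:R * t (u n - u m) (u n - u m)) / 2.
    have fv : (f - j (u n)) + (f - j (u m)) = (f - j v) *+ 2.
      by rewrite addrACA -opprD -linearD v2 linearMn mulrnBl mulr2n.
    have := hermitian_midpoint ip _ _ _ fv.
    have -> : f - j (u n) - (f - j (u m)) = j (u m - u n).
      by rewrite opprB addrC subrKA linearB.
    rewrite ip_form -(opprB (u n)) hnormN => ipv.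
    have tv := hermitian_midpoint t _ _ _ v2.
    by rewrite /G addrACA ipv -mulrDr tv; field.
  (* The penalty grows with the index, so [G n (u m) <= G m (u m)]. *)
  have Gum : G n (u m) <= mu m + (m.+1%:R : K)^-1%R ^+ 2.
    by apply: le_trans (Gu m); rewrite lerD2l ler_wpM2r// ler_nat ltnS.
  have := lerD (Gu n) Gum; rewrite Gv.
  have := muG n v.
  set q := s _ _; set r := t _ _; set en := _^-1%R ^+ 2; set em := _^-1%R ^+ 2.
  move=> mule Gle.
  have q_le : q <= (mu m - mu n + (en + em)) *+ 2.
    apply: (@le_trans _ _ (q + n.+1%:R * r)).
      by rewrite lerDl mulr_ge0 ?t_ge0.
    rewrite -subr_ge0.
    (* The difference is twice the slack in near-minimality of [u n] and [u m] plus four times the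
       slack in minimality at [v]. *)
    have -> : (mu m - mu n + (en + em)) *+ 2 - (q + n.+1%:R * r) =
      (mu n + en + (mu m + em) - (G n v *+ 2 + (q + n.+1%:R * r) / 2)) *+ 2
      + (G n v - mu n) *+ 4 by field.
    by rewrite addr_ge0// mulrn_wge0// subr_ge0.
  apply: le_trans q_le _; rewrite lerMn2r/= lerD2r distrC real_ler_norm//.
  by rewrite rpredB ?mu_real.
have u_cauchy :
    s (u p.1 - u p.2) (u p.1 - u p.2) @[p --> (\oo, \oo)] --> (0 : K).
  pose g p := (`|mu p.1 - mu p.2| +
    ((p.1.+1%:R : K)^-1%R ^+ 2 + (p.2.+1%:R : K)^-1%R ^+ 2)) *+ 2.
  apply: (@ge0_le_cvg0 _ _ _ _ _ g) => [[n m]/=|].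
    rewrite s_ge0/=.
    have [nm|/ltnW mn] := leqP n m; first exact: u_le.
    rewrite -opprB hnormN /g/= distrC (addrC (_ ^+ 2)).
    exact: u_le.
  have inv1 : (p.1.+1%:R : K)^-1%R @[p --> (\oo, \oo)] --> (0 : K).
    exact: (cvg_comp _ _ cvg_fst (cvg_inv_succ hK)).
  have inv2 : (p.2.+1%:R : K)^-1%R @[p --> (\oo, \oo)] --> (0 : K).
    exact: (cvg_comp _ _ cvg_snd (cvg_inv_succ hK)).
  have mu1 : mu p.1 @[p --> (\oo, \oo)] --> lim (mu n @[n --> \oo]).
    exact: (cvg_comp _ _ cvg_fst mu_cvg).
  have mu2 : mu p.2 @[p --> (\oo, \oo)] --> lim (mu n @[n --> \oo]).
    exact: (cvg_comp _ _ cvg_snd mu_cvg).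
  set l := lim _ in mu1 mu2.
  have -> : 0 = (`|l - l| + (0 ^+ 2 + 0 ^+ 2)) *+ 2 :> K.
    by rewrite subrr normr0 expr0n/= !addr0 mul0rn.
  apply: cvgMn; apply: cvgD; first exact: cvg_norm (cvgB mu1 mu2).
  by apply: cvgD; exact: cvgM.
have su0 : s (u n) (u n) @[n --> \oo] --> (0 : K).
  apply: s_ac_t u_cauchy.
  (* Comparison with the competitor 0, where [G n] equals [ip f f]; the added 1 bounds the
     tolerance. *)
  apply: (@ge0_le_cvg0 _ _ _ _ _ (fun n => (ip f f + 1) * (n.+1%:R : K)^-1%R)).
    move=> n; rewrite t_ge0/= ler_pdivlMr ?ltr0Sn// mulrC.
    apply: (@le_trans _ _ (G n (u n))); first by rewrite lerDr.
    apply: le_trans (Gu n) _; apply: lerD; first by rewrite -(G0 n).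
    by rewrite expr_le1// ?invf_le1// ler1n.
  rewrite -(mulr0 (ip f f + 1)).
  by apply: cvgM; [exact: cvg_cst|exact: (cvg_inv_succ hK)].
(* The error splits as [b n x + s x (u n)]: the first summand comes from [b_le], the second from
   Cauchy-Schwarz, and the doubling from squaring a sum. *)
pose c n := ((n.+1%:R : K)^-1%R + s (u n) (u n)) *+ 2.
have c0 : c n @[n --> \oo] --> (0 : K).
  have -> : 0 = (0 + 0) *+ 2 :> K by rewrite addr0 mul0rn.
  by apply: cvgMn; apply: cvgD => //; exact: (cvg_inv_succ hK).
have err n x : `|ip (j x) f - t x (u n *+ n.+1)| ^+ 2 <= c n * (s x x + t x x).
  have -> : ip (j x) f - t x (u n *+ n.+1) = b n x + s x (u n).
    have -> : t x (u n *+ n.+1) = n.+1%:R * t x (u n).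
      by rewrite mulr_natl; exact: linearMnr.
    have -> : b n x = ip (j x) f - s x (u n) - n.+1%:R * t x (u n).
      by rewrite -ip_form /b; congr (_ - _); exact: linearBr.
    by rewrite addrAC subrK.
  apply: le_trans (normD_sqr_le _ _) _; rewrite /c mulrnAl lerMn2r/= mulrDl.
  apply: lerD => //.
  apply: le_trans (hermitian_Cauchy_Schwarz conjN _ s_ge0 _ _) _.
  by rewrite ler_wpM2l// lerDl.
exists (fun n => u n *+ n.+1), c; split=> // n.
by rewrite mulrn_wge0// addr_ge0// invr_ge0.
Qed.

(** * Pointwise and uniform convergence *)

Theorem theorem2p1 (R : realType) (K : numFieldType)
    (conj : {rmorphism K -> K}) (hK : real_or_complex R conj)
    (D : lmodType K) (s t : {hermitian_sym D for conj})
    (s_ge0 : nonneg_form s) (t_ge0 : nonneg_form t)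
    (s_ac_t : abs_continuous s t)
    (Hs : completeNormedModType K) (ip_s : {dot Hs for conj})
    (j : {linear D -> Hs}) (Hs_completion : is_completion s ip_s j) :
  forall f : Hs, exists x_ : nat -> D,
    (forall x : D, t x (x_ n) @[n --> \oo] --> ip_s (j x) f) /\
    {uniform [set x : D | s x x + t x x <= 1],
      (fun n x => t x (x_ n)) @ \oo --> (fun x => ip_s (j x) f)}.
Proof.
move=> f.
have [ip_norm ip_form _] := Hs_completion.
have ip_ge0 : nonneg_form ip_s.
  by move=> h; suff : 0 <= ip_s h h by []; rewrite -ip_norm exprn_ge0.
have [x_ [c [c0 c_ge0 err]]] :=
  abs_continuous_approx hK s_ge0 t_ge0 s_ac_t ip_s ip_ge0 j ip_form f.
exists x_.
(* Used with [M = s x x + t x x] for the pointwise limit and with [M = 1] for the uniform one. *)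
have uniform_small (M e : K) : 0 < e -> \forall n \near \oo, forall x,
    s x x + t x x <= M -> `|ip_s (j x) f - t x (x_ n)| < e.
  move=> e0.
  have : c n * M @[n --> \oo] --> (0 : K).
    by rewrite -(mul0r M); apply: cvgM => //; exact: cvg_cst.
  move=> /cvgr0Pnorm_lt /(_ (e ^+ 2)) /(_ (exprn_gt0 _ e0)).
  apply: filterS => n cM x xM.
  rewrite -(ltr_pXn2r (n := 2)) ?nnegrE// ?ltW//.
  apply: le_lt_trans (err n x) (le_lt_trans _ cM).
  have st0 : 0 <= s x x + t x x by rewrite addr_ge0.
  by rewrite ger0_norm ?ler_wpM2l// mulr_ge0// (le_trans st0).
split=> [x|].
  apply/cvgrPdist_lt => e /(uniform_small (s x x + t x x)).
  by apply: filterS => n; apply.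
move=> P /uniform_nbhs[E [entE EP]].
move: entE; rewrite -entourage_ballE => -[e /= e0 eE].
have := uniform_small 1 e e0; apply: filterS => n small.
by apply: EP => x x1; apply: eE; exact: small.
Qed.
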